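(* Let $k^+,k^-$ be positive integers. Let $Z^\pm=(X^\pm,Y^\pm)$ be smooth vector fields on a neighborhood $V$ of the origin in $\mathbb{R}^2$, and assume that the Filippov vector field $Z$ equal to $Z^+$ for $y>0$ and to $Z^-$ for $y<0$ has a $(2k^+,2k^-)$-tangential center at the origin. Let $\varphi$ be the associated half-return map, let $\delta=\operatorname{sign}(X^+(0,0))=-\operatorname{sign}(X^-(0,0))$, and let $t\mapsto y^\pm(t,x)$ be the solution of $$\frac{dy}{dt}=\eta^\pm(x\pm\delta t,\,y),\qquad y(0)=0,$$ where $\eta^+=\delta\, Y^+/X^+$ and $\eta^-=-\delta\, Y^-/X^-$ (defined in a neighborhood of the origin). Then the period function of $Z$ around the origin is given by $$T(x)=\delta\,\big(T^-(x)-T^+(x)\big),$$ where $$T^\pm(x)=(\varphi(x)-x)\int_0^1\frac{1}{X^\pm\big(x+(\varphi(x)-x)t,\;y^\pm(\pm\delta(\varphi(x)-x)t,\,x)\big)}\,dt .$$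
   Context: The discontinuity manifold of $Z$ is $\Sigma=\{(x,y)\in V: y=0\}$, and trajectories follow Filippov's convention (at points of $\Sigma$ where $Y^+Y^->0$, trajectories of $Z^+$ and $Z^-$ are concatenated). The origin is a $(2k^+,2k^-)$-monodromic tangential singularity of $Z$ if it is an invisible $2k^+$-multiplicity contact of $Z^+$ with $\Sigma$ and an invisible $2k^-$-multiplicity contact of $Z^-$ with $\Sigma$, and $Z$ has a first-return map defined on $\Sigma$ around the origin. (With $h(x,y)=y$, $Fh=\langle\nabla h,F\rangle$ and $F^nh=F(F^{n-1}h)$, an invisible $2k$-multiplicity contact of $Z^\pm$ at $p$ means $(Z^\pm)^ih(p)=0$ for $1\le i\le 2k-1$, with $(Z^+)^{2k}h(p)<0$, resp. $(Z^-)^{2k}h(p)>0$.) This is equivalent to the following three conditions: (C1) $X^\pm(0,0)\ne0$, $Y^\pm(0,0)=0$, $\frac{\partial^iY^\pm}{\partial x^i}(0,0)=0$ for $i=1,\dots,2k^\pm-2$, and $\frac{\partial^{2k^\pm-1}Y^\pm}{\partial x^{2k^\pm-1}}(0,0)\neq0$; (C2) $X^+(0,0)\frac{\partial^{2k^+-1}Y^+}{\partial x^{2k^+-1}}(0,0)<0$ and $X^-(0,0)\frac{\partial^{2k^--1}Y^-}{\partial x^{2k^--1}}(0,0)>0$; (C3) $X^+(0,0)X^-(0,0)<0$. The half-return maps $\varphi^+$ and $\varphi^-$ on $\Sigma$ around $0$ are defined by the flows of $Z^+|_{y\ge0}$ and $Z^-|_{y\le0}$: $(\varphi^\pm(x),0)$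 is the other endpoint on $\Sigma$ of the arc of trajectory of $Z^\pm$ in $\{\pm y\ge0\}$ having $(x,0)$ as an endpoint (followed in forward or backward time as needed), with $\varphi^\pm(0)=0$. The origin is a $(2k^+,2k^-)$-tangential center if moreover the first-return map is the identity near the origin; then $\varphi^+=\varphi^-$, and this common map is denoted $\varphi$; it is known to be a smooth involution near $0$ with $\varphi(0)=0$. The period function $T(x)$, for $x\ge0$ small, is the period of the closed trajectory of $Z$ through $(x,0)$, i.e. the total (nonnegative) time spent on the arc of $Z^+$ and the arc of $Z^-$ joining $(x,0)$ and $(\varphi(x),0)$, with $T(0)=0$. *)

(* Defs.v *)
(* Stdlib reals with Coquelicot.
   Subsets of the plane are [R -> R -> Prop]; a vector field is given by its
   two components [X Y : R -> R -> R], only their values on [V] being relevant.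
   A sign [s] selects the half-plane: [s = 1] for {y >= 0} and [s = -1] for
   {y <= 0}.  The discontinuity line is {y = 0}. *)
From Stdlib Require Export Reals.
From Coquelicot Require Export Coquelicot.
Open Scope R_scope.

Definition open_2d (V : R -> R -> Prop) : Prop :=
  forall x y, V x y -> locally_2d V x y.

(* [ex_diff_n f n] asks for all iterated partial derivatives up to order [n],
   in any order of differentiation, to exist and be continuous. *)
Definition smooth_on (V : R -> R -> Prop) (f : R -> R -> R) : Prop :=
  forall (n : nat) x y, V x y -> ex_diff_n f n x y.

(* F g = <grad g, F> for F = (X, Y). *)
Definition lie (X Y g : R -> R -> R) : R -> R -> R :=
  fun x y =>
    X x y * Derive (fun u => g u y) x + Y x y * Derive (fun v => g x v) y.

(* F^n h for h (x, y) = y. *)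
Definition lie_iter_h (X Y : R -> R -> R) (n : nat) : R -> R -> R :=
  Nat.iter n (lie X Y) (fun _ y => y).

(* Invisible contact of multiplicity 2k at the origin; the last condition is
   F^{2k} h < 0 for the upper field and F^{2k} h > 0 for the lower one. *)
Definition invisible_contact (s : R) (X Y : R -> R -> R) (k : nat) : Prop :=
  (forall i : nat, (1 <= i <= 2 * k - 1)%nat -> lie_iter_h X Y i 0 0 = 0) /\
  s * lie_iter_h X Y (2 * k) 0 0 < 0.

(* [arc s V X Y a b tau]: the trajectory of (X, Y) starting at (a, 0) reaches
   {y = 0} for the first time at (b, 0), after the time [tau], and stays in
   {s y > 0} in between.  Derivatives at the endpoints are two-sided: since the
   endpoints lie in the open set [V], trajectories extend past them. *)
Definition arc (s : R) (V : R -> R -> Prop) (X Y : R -> R -> R)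
    (a b tau : R) : Prop :=
  0 < tau /\
  exists u v : R -> R,
    u 0 = a /\ v 0 = 0 /\ u tau = b /\ v tau = 0 /\
    (forall t, 0 <= t <= tau ->
       V (u t) (v t) /\
       is_derive u t (X (u t) (v t)) /\
       is_derive v t (Y (u t) (v t))) /\
    (forall t, 0 < t < tau -> 0 < s * v t).

(* First return of the Filippov trajectory through (a, 0) around the origin:
   an arc of one field from (a, 0) to a point (m, 0) on the other side of the
   origin, followed by an arc of the other field from (m, 0) to (b, 0).  The
   arcs are concatenated at (m, 0) because Y^+ Y^- > 0 there.  [tau] is the
   return time. *)
Definition first_return (V : R -> R -> Prop) (Xp Yp Xm Ym : R -> R -> R)
    (a b tau : R) : Prop :=
  exists m tau1 tau2 : R,
    a * m < 0 /\ m * b < 0 /\ tau = tau1 + tau2 /\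
    0 < Yp m 0 * Ym m 0 /\
    ((arc 1 V Xp Yp a m tau1 /\ arc (-1) V Xm Ym m b tau2) \/
     (arc (-1) V Xm Ym a m tau1 /\ arc 1 V Xp Yp m b tau2)).

Definition monodromic_tangential_singularity (kp km : nat)
    (V : R -> R -> Prop) (Xp Yp Xm Ym : R -> R -> R) : Prop :=
  invisible_contact 1 Xp Yp kp /\
  invisible_contact (-1) Xm Ym km /\
  exists eps : R, 0 < eps /\
    forall a, 0 < Rabs a < eps ->
      exists b tau, first_return V Xp Yp Xm Ym a b tau.

Definition tangential_center (kp km : nat)
    (V : R -> R -> Prop) (Xp Yp Xm Ym : R -> R -> R) : Prop :=
  monodromic_tangential_singularity kp km V Xp Yp Xm Ym /\
  exists eps : R, 0 < eps /\
    forall a b tau, 0 < Rabs a < eps ->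
      first_return V Xp Yp Xm Ym a b tau -> b = a.

(* [phi] is a representative, near 0, of the half-return map of the field
   (X, Y) in {s y >= 0}; the arc is followed forward or backward in time. *)
Definition half_return_map (s : R) (V : R -> R -> Prop) (X Y : R -> R -> R)
    (phi : R -> R) : Prop :=
  phi 0 = 0 /\
  exists eps : R, 0 < eps /\
    forall x, 0 < Rabs x < eps ->
      exists tau, arc s V X Y x (phi x) tau \/ arc s V X Y (phi x) x tau.

(* T x is the period of the closed trajectory through (x, 0). *)
Definition period_function (V : R -> R -> Prop) (Xp Yp Xm Ym : R -> R -> R)
    (T : R -> R) : Prop :=
  T 0 = 0 /\
  exists eps : R, 0 < eps /\
    forall x, 0 < x < eps -> first_return V Xp Yp Xm Ym x x (T x).

(* eta^+ = delta Y^+ / X^+ and eta^- = - delta Y^- / X^-. *)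
Definition eta (s delta : R) (X Y : R -> R -> R) : R -> R -> R :=
  fun x y => s * delta * (Y x y / X x y).

(* [y t x] is the solution of dy/dt = eta (x + s delta t, y), y(0) = 0, for
   [x] and [t] near 0; its graph stays in {X <> 0}, where eta is defined. *)
Definition slope_solution (s delta : R) (V : R -> R -> Prop)
    (X Y : R -> R -> R) (y : R -> R -> R) : Prop :=
  exists r : R, 0 < r /\
    forall x, Rabs x < r ->
      y 0 x = 0 /\
      forall t, Rabs t < r ->
        V (x + s * delta * t) (y t x) /\
        X (x + s * delta * t) (y t x) <> 0 /\
        is_derive (fun t' => y t' x) t
          (eta s delta X Y (x + s * delta * t) (y t x)).

(* T^+ (s = 1) and T^- (s = -1). *)
Definition half_time (s delta : R) (X : R -> R -> R) (phi : R -> R)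
    (y : R -> R -> R) (x : R) : R :=
  (phi x - x) *
  RInt (fun t => 1 / X (x + (phi x - x) * t)
                       (y (s * delta * (phi x - x) * t) x)) 0 1.

(* Main.v *)
Require Import Defs.
From Stdlib Require Import Lra Lia Ranalysis5.
Open Scope R_scope.

(** Near the origin [X] does not vanish, so a trajectory of [(X, Y)] is the graph
    of a solution of the scalar equation [dg/dx = Y/X]; reparametrised by
    [x = a + s * delta * t], the function [y t a] is the solution [g] with
    [g a = 0].  Along an arc from [(x, 0)] to [(phi x, 0)] one has [dt = du / X],
    so the signed time from the first point to the second is the integral of
    [1 / X (u, g u)] for [u] from [x] to [phi x], which is [half_time] after the
    substitution [u = x + (phi x - x) * t].  The closed trajectory runs from [x]
    to [phi x] along the field that points to the left at the origin, and comes
    back along the other one; the first time counts positively, the second one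
    negatively, and the sign [delta] tells which field is which.

    The substance of the proof is that the arcs, which are only assumed to stay
    in [V], do not leave the region where this description holds
    ([arcs_near_contact]).  The graph [g0] through the origin satisfies
    [s * g0 x < 0] for small [x <> 0]: the functions [F^i h] restricted to that
    graph satisfy [h_i' = h_(i+1) / X], they vanish at [0] for [i < 2k], and
    [s * h_(2k) < 0], so the sign passes down from [h_(2k)] to [h_0 = g0] two
    derivatives at a time ([invisible_contact_graph]).  By Gronwall's inequality the
    graph through [(a, 0)] with [a] small is close to [g0], hence it is also on
    the wrong side of the axis at the vertical boundary of a small box.  An arc
    starting at [(a, 0)] follows this graph while it is in the box, it moves
    monotonically in [x], and it cannot reach the boundary because it has to
    stay in [s y >= 0] ([arc_returns_along]).  Consequently its endpoint is the
    first zero of the graph in the direction of the field, which also gives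
    uniqueness of the endpoint.

    The half-return map may be realised by an arc followed forward or backward.
    Arcs that end at [(a, 0)] are treated as arcs of the field [(- X, - Y)] that
    start there; both fields have the same slope graphs.  For [x > 0], an arc of
    the left-going field from [phi x] to [x] would make [phi x] a small positive
    number whose arc returns to the positive side, against the existence of
    first returns around the origin.  Hence [phi x] is the point of the closed
    trajectory on the negative side ([return_time]). *)

(** * Real analysis on intervals *)

(** Least upper bound argument for a property that is open along the interval and
    passes to the right end of half-open intervals; it shows below that curves
    do not leave boxes. *)
Lemma interval_induction (a b : R) (P : R -> Prop) :
  (forall t, a <= t <= b -> P t -> locally t P) ->
  (forall t, a <= t <= b -> (forall t', a <= t' < t -> P t') -> P t) ->
  forall t, a <= t <= b -> P t.
Proof.
intros Hopen Hclosed t0 Ht0.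
set (E := fun t => a <= t <= t0 /\ forall t', a <= t' <= t -> P t').
assert (Pa : P a) by (apply Hclosed; [lra | intros; lra]).
assert (Ea : E a).
{ split; [lra|]. intros t' Ht'. now replace t' with a by lra. }
destruct (completeness E) as [m [Hub Hlub]].
{ exists t0. intros t [Ht _]. lra. }
{ now exists a. }
assert (Hm : a <= m <= t0).
{ split; [now apply Hub|]. apply Hlub. intros t [Ht _]. lra. }
assert (Hbelow : forall t', a <= t' < m -> P t').
{ intros t' Ht'. apply Classical_Prop.NNPP. intros Hn.
  assert (m <= t'); [|lra].
  apply Hlub. intros t [Ht HP]. apply Rnot_lt_le. intros Hlt.
  apply Hn, HP. lra. }
assert (Pm : P m) by (apply Hclosed; [lra | exact Hbelow]).
destruct (Hopen m ltac:(lra) Pm) as [d Hd].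
assert (Hnear : forall t', a <= t' < m + d -> P t').
{ intros t' Ht'. destruct (Rlt_le_dec t' m) as [H|H]; [apply Hbelow; lra|].
  apply Hd. change (Rabs (t' - m) < d). apply Rabs_def1; lra. }
pose proof (cond_pos d) as Hdpos.
apply Hnear. split; [lra|].
apply Rnot_le_lt. intros Hle.
assert (m + d / 2 <= m); [|lra].
apply Hub. split; [lra|]. intros t' Ht'. apply Hnear. lra.
Qed.

Lemma nonincreasing_of_derive (f f' : R -> R) (a b : R) :
  a <= b -> (forall t, a <= t <= b -> is_derive f t (f' t) /\ f' t <= 0) ->
  f b <= f a.
Proof.
intros Hab H. destruct Hab as [Hab|Hab]; [|rewrite Hab; lra].
destruct (MVT_cor2 f f' a b Hab) as [c [Hc Hcb]].
{ intros c Hc. apply is_derive_Reals. now apply H. }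
destruct (H c ltac:(lra)) as [_ Hf']. nra.
Qed.

Lemma is_derive_continuous (f : R -> R) (x l : R) : is_derive f x l -> continuous f x.
Proof.
intros H. apply (ex_derive_continuous (K := R_AbsRing) (V := R_NormedModule)).
now exists l.
Qed.

(** The square of [w] times [exp (- 2 K t)] is nonincreasing. *)
Lemma gronwall_forward (K : R) (w w' : R -> R) (a b : R) :
  a <= b ->
  (forall t, a <= t <= b -> is_derive w t (w' t) /\ Rabs (w' t) <= K * Rabs (w t)) ->
  Rabs (w b) <= Rabs (w a) * exp (K * (b - a)).
Proof.
intros Hab H.
assert (Hsq : (w b * exp (- K * (b - a)))^2 <= (w a * exp (- K * (a - a)))^2).
{ apply (nonincreasing_of_derive
    (fun t => (w t * exp (- K * (t - a)))^2)
    (fun t => 2 * (w t * w' t - K * w t * w t) * (exp (- K * (t - a)))^2)); [lra|].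
  intros t Ht. destruct (H t Ht) as [Hd Hle]. split.
  - assert (He : ex_derive w t) by (eexists; exact Hd).
    assert (HD : Derive w t = w' t) by now apply is_derive_unique.
    auto_derive; [exact He|]. change (fun x => w x) with w. rewrite HD. unfold Rminus. ring.
  - assert (w t * w' t <= K * w t * w t).
    { apply Rle_trans with (Rabs (w t) * Rabs (w' t)).
      - rewrite <- Rabs_mult. apply Rle_abs.
      - replace (K * w t * w t) with (Rabs (w t) * (K * Rabs (w t))).
        + apply Rmult_le_compat_l; [apply Rabs_pos | exact Hle].
        + replace (Rabs (w t) * (K * Rabs (w t))) with (K * (Rabs (w t) * Rabs (w t))) by ring.
          rewrite <- Rabs_mult, Rabs_pos_eq; [ring | nra]. }
    pose proof (pow2_ge_0 (exp (- K * (t - a)))). nra. }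
replace (- K * (a - a)) with 0 in Hsq by ring. rewrite exp_0, Rmult_1_r in Hsq.
rewrite <- !Rsqr_pow2 in Hsq. apply Rsqr_le_abs_0 in Hsq.
rewrite Rabs_mult, (Rabs_pos_eq (exp _)) in Hsq by (left; apply exp_pos).
replace (K * (b - a)) with (- (- K * (b - a))) by ring.
rewrite exp_Ropp. pose proof (exp_pos (- K * (b - a))).
apply Rmult_le_reg_r with (exp (- K * (b - a))); [assumption|].
rewrite Rmult_assoc, Rinv_l by lra. lra.
Qed.

(** The base point [a] may lie on either side of [b]: graphs are followed in both
    directions. *)
Lemma gronwall (K : R) (w w' : R -> R) (a b : R) :
  (forall t, Rmin a b <= t <= Rmax a b ->
     is_derive w t (w' t) /\ Rabs (w' t) <= K * Rabs (w t)) ->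
  Rabs (w b) <= Rabs (w a) * exp (K * Rabs (b - a)).
Proof.
intros H. destruct (Rle_lt_dec a b) as [Hab|Hab].
- rewrite Rmin_left, Rmax_right in H by lra.
  rewrite (Rabs_pos_eq (b - a)) by lra.
  now apply gronwall_forward with w'.
- rewrite Rmin_right, Rmax_left in H by lra.
  rewrite (Rabs_left (b - a)) by lra.
  pose proof (gronwall_forward K (fun t => w (- t)) (fun t => - w' (- t)) (- a) (- b)) as G.
  cbv beta in G. rewrite !Ropp_involutive in G.
  replace (- (b - a)) with (- b - - a) by ring.
  apply G; [lra|]. intros t Ht. destruct (H (- t) ltac:(lra)) as [Hd Hle]. split.
  + evar_last. { apply (is_derive_comp w Ropp t _ (-1) Hd). auto_derive; [exact I|ring]. }
    unfold scal; simpl; unfold mult; simpl; ring.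
  + now rewrite Rabs_Ropp.
Qed.

Lemma locally_Rabs (P : R -> Prop) (x : R) :
  locally x P -> exists d, 0 < d /\ forall t, Rabs (t - x) < d -> P t.
Proof. intros [d Hd]. exists d. split; [apply cond_pos | exact Hd]. Qed.

Lemma continuous_pos (f : R -> R) (x : R) :
  continuous f x -> 0 < f x -> exists d, 0 < d /\ forall t, Rabs (t - x) < d -> 0 < f t.
Proof.
intros Hc Hp. apply locally_Rabs. apply (Hc (fun y => 0 < y)). now apply open_gt.
Qed.

Lemma le_of_left_limit (f : R -> R) (c t : R) :
  0 < t -> continuous f t -> (forall t', 0 <= t' < t -> f t' <= c) -> f t <= c.
Proof.
intros Ht Hf H. apply Rnot_lt_le. intros Hlt.
destruct (locally_Rabs _ _ (Hf (fun y => c < y) (open_gt c (f t) Hlt))) as [d [Hd Hn]].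
set (t' := Rmax 0 (t - d / 2)).
assert (Ht' : 0 <= t' < t /\ Rabs (t' - t) < d).
{ unfold t', Rmax. destruct (Rle_dec 0 (t - d / 2)); (split; [lra|apply Rabs_def1; lra]). }
specialize (Hn t' ltac:(lra)). specialize (H t' ltac:(lra)). cbv beta in Hn. lra.
Qed.

Lemma mean_value_from_0 (f f' : R -> R) (x : R) :
  x <> 0 -> (forall t, Rabs t <= Rabs x -> is_derive f t (f' t)) ->
  exists c, f x - f 0 = f' c * x /\ 0 < c * x /\ Rabs c < Rabs x.
Proof.
intros Hx H.
assert (Hd : forall t, Rabs t <= Rabs x -> derivable_pt_lim f t (f' t)).
{ intros t Ht. now apply is_derive_Reals, H. }
destruct (Rdichotomy _ _ Hx) as [Hn|Hp].
- destruct (MVT_cor2 f f' x 0 Hn) as [c [Hc Hcx]].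
  { intros c Hc. apply Hd. rewrite !Rabs_left1; lra. }
  exists c. rewrite !Rabs_left by lra. split; [lra|]. split; [nra|lra].
- destruct (MVT_cor2 f f' 0 x Hp) as [c [Hc Hcx]].
  { intros c Hc. apply Hd. rewrite !Rabs_right; lra. }
  exists c. rewrite !Rabs_right by lra. split; [lra|]. split; [nra|lra].
Qed.

Lemma lipschitz_of_derive (f : R -> R) (B rho y y' : R) :
  (forall z, Rabs z < rho -> ex_derive f z /\ Rabs (Derive f z) <= B) ->
  Rabs y < rho -> Rabs y' < rho -> Rabs (f y - f y') <= B * Rabs (y - y').
Proof.
intros H Hy Hy'.
assert (Hin : forall z, Rmin y' y <= z <= Rmax y' y -> Rabs z < rho).
{ intros z. apply Rabs_def2 in Hy, Hy'. unfold Rmin, Rmax.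
  destruct (Rle_dec y' y); intros; apply Rabs_def1; lra. }
destruct (MVT_gen f y' y (Derive f)) as [c [Hc E]].
- intros z Hz. apply Derive_correct, H, Hin; lra.
- intros z Hz. apply continuity_pt_filterlim.
  apply (ex_derive_continuous (K := R_AbsRing) (V := R_NormedModule)). now apply H, Hin.
- rewrite E, Rabs_mult. apply Rmult_le_compat_r; [apply Rabs_pos|]. now apply H, Hin.
Qed.

(** * Smooth functions on an open set of the plane *)

Lemma locally_2d_on (V : R -> R -> Prop) (P : R -> R -> Prop) x y :
  open_2d V -> V x y -> (forall u v, V u v -> P u v) -> locally_2d P x y.
Proof.
intros HV Hxy HP. destruct (HV x y Hxy) as [d Hd].
exists d. intros u v Hu Hv. apply HP, Hd; assumption.
Qed.

Lemma smooth_derive_x (V : R -> R -> Prop) f :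
  smooth_on V f -> smooth_on V (fun u v => Derive (fun z => f z v) u).
Proof. intros H n x y Hxy. now apply ex_diff_n_deriv_aux1, H. Qed.

Lemma smooth_derive_y (V : R -> R -> Prop) f :
  smooth_on V f -> smooth_on V (fun u v => Derive (fun z => f u z) v).
Proof. intros H n x y Hxy. now apply ex_diff_n_deriv_aux2, H. Qed.

Lemma smooth_continuous V f x y : smooth_on V f -> V x y -> continuity_2d_pt f x y.
Proof. intros H Hxy. exact (proj1 (H 0%nat x y Hxy)). Qed.

Lemma smooth_ex_derive_x V f x y :
  smooth_on V f -> V x y -> ex_derive (fun z => f z y) x.
Proof. intros H Hxy. exact (proj1 (proj2 (H 1%nat x y Hxy))). Qed.

Lemma smooth_ex_derive_y V f x y :
  smooth_on V f -> V x y -> ex_derive (fun z => f x z) y.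
Proof. intros H Hxy. exact (proj1 (proj2 (proj2 (H 1%nat x y Hxy)))). Qed.

Lemma smooth_const V (c : R) : smooth_on V (fun _ _ => c).
Proof.
intros n x y _. revert c x y.
induction n as [|n IH]; intros c x y; simpl; (split; [apply continuity_2d_pt_const|]).
- exact I.
- repeat split; try apply ex_derive_const.
  all: apply ex_diff_n_ext_loc with (fun _ _ => 0); [|apply IH];
    apply locally_2d_forall; intros u v; symmetry; apply Derive_const.
Qed.

Lemma smooth_snd V : smooth_on V (fun _ y => y).
Proof.
intros n x y _. destruct n as [|n]; simpl; (split; [apply continuity_2d_pt_id2|]).
- exact I.
- repeat split; [apply ex_derive_const | apply ex_derive_id | |].
  + apply ex_diff_n_ext_loc with (fun _ _ => 0).
    * apply locally_2d_forall; intros u v; symmetry; apply Derive_const.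
    * now apply (smooth_const (fun _ _ => True)).
  + apply ex_diff_n_ext_loc with (fun _ _ => 1).
    * apply locally_2d_forall; intros u v; symmetry; apply Derive_id.
    * now apply (smooth_const (fun _ _ => True)).
Qed.

(** Stated at a fixed order so that the induction for products can lower the order
    of one factor. *)
Lemma ex_diff_n_plus (V : R -> R -> Prop) (n : nat) (f g : R -> R -> R) :
  open_2d V ->
  (forall x y, V x y -> ex_diff_n f n x y) ->
  (forall x y, V x y -> ex_diff_n g n x y) ->
  forall x y, V x y -> ex_diff_n (fun u v => f u v + g u v) n x y.
Proof.
intros hV. revert f g. induction n as [|n IH]; intros f g Hf Hg x y Hxy.
- split; [|exact I].
  apply continuity_2d_pt_plus; [apply Hf | apply Hg]; exact Hxy.
- destruct (Hf x y Hxy) as [Cf [Fx [Fy _]]].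
  destruct (Hg x y Hxy) as [Cg [Gx [Gy _]]].
  split; [now apply continuity_2d_pt_plus|].
  split; [now apply (ex_derive_plus (fun z => f z y) (fun z => g z y))|].
  split; [now apply (ex_derive_plus (fun z => f x z) (fun z => g x z))|].
  split.
  + apply ex_diff_n_ext_loc with
      (fun u v => Derive (fun z => f z v) u + Derive (fun z => g z v) u).
    * apply locally_2d_on with V; trivial. intros u v Huv. symmetry.
      apply Derive_plus; [apply (Hf u v Huv) | apply (Hg u v Huv)].
    * apply IH; trivial; intros; apply ex_diff_n_deriv_aux1; auto.
  + apply ex_diff_n_ext_loc with
      (fun u v => Derive (fun z => f u z) v + Derive (fun z => g u z) v).
    * apply locally_2d_on with V; trivial. intros u v Huv. symmetry.
      destruct (Hf u v Huv) as [_ [_ [? _]]], (Hg u v Huv) as [_ [_ [? _]]].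
      now apply Derive_plus.
    * apply IH; trivial; intros; apply ex_diff_n_deriv_aux2; auto.
Qed.

Lemma ex_diff_n_mult (V : R -> R -> Prop) (n : nat) (f g : R -> R -> R) :
  open_2d V ->
  (forall x y, V x y -> ex_diff_n f n x y) ->
  (forall x y, V x y -> ex_diff_n g n x y) ->
  forall x y, V x y -> ex_diff_n (fun u v => f u v * g u v) n x y.
Proof.
intros hV. revert f g. induction n as [|n IH]; intros f g Hf Hg x y Hxy.
- split; [|exact I].
  apply continuity_2d_pt_mult; [apply Hf | apply Hg]; exact Hxy.
- destruct (Hf x y Hxy) as [Cf [Fx [Fy _]]].
  destruct (Hg x y Hxy) as [Cg [Gx [Gy _]]].
  assert (Hf' : forall x y, V x y -> ex_diff_n f n x y).
  { intros u v Huv. apply ex_diff_n_m with (S n); [lia | now apply Hf]. }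
  assert (Hg' : forall x y, V x y -> ex_diff_n g n x y).
  { intros u v Huv. apply ex_diff_n_m with (S n); [lia | now apply Hg]. }
  split; [now apply continuity_2d_pt_mult|].
  split; [now apply (ex_derive_mult (fun z => f z y) (fun z => g z y))|].
  split; [now apply (ex_derive_mult (fun z => f x z) (fun z => g x z))|].
  split.
  + apply ex_diff_n_ext_loc with
      (fun u v => Derive (fun z => f z v) u * g u v + f u v * Derive (fun z => g z v) u).
    * apply locally_2d_on with V; trivial. intros u v Huv. symmetry.
      apply (Derive_mult (fun z => f z v) (fun z => g z v));
        [apply (Hf u v Huv) | apply (Hg u v Huv)].
    * apply (ex_diff_n_plus V n (fun u v => Derive (fun z => f z v) u * g u v)
        (fun u v => f u v * Derive (fun z => g z v) u)); trivial;
      apply IH; trivial; intros; apply ex_diff_n_deriv_aux1; auto.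
  + apply ex_diff_n_ext_loc with
      (fun u v => Derive (fun z => f u z) v * g u v + f u v * Derive (fun z => g u z) v).
    * apply locally_2d_on with V; trivial. intros u v Huv. symmetry.
      destruct (Hf u v Huv) as [_ [_ [? _]]], (Hg u v Huv) as [_ [_ [? _]]].
      now apply (Derive_mult (fun z => f u z) (fun z => g u z)).
    * apply (ex_diff_n_plus V n (fun u v => Derive (fun z => f u z) v * g u v)
        (fun u v => f u v * Derive (fun z => g u z) v)); trivial;
      apply IH; trivial; intros; apply ex_diff_n_deriv_aux2; auto.
Qed.

Lemma smooth_lie V X Y g :
  open_2d V -> smooth_on V X -> smooth_on V Y -> smooth_on V g -> smooth_on V (lie X Y g).
Proof.
intros hV HX HY Hg n x y Hxy. unfold lie.
apply (ex_diff_n_plus V n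
  (fun x y => X x y * Derive (fun u => g u y) x)
  (fun x y => Y x y * Derive (fun v => g x v) y) hV); trivial.
- apply (ex_diff_n_mult V n X (fun x y => Derive (fun u => g u y) x) hV).
  + apply HX.
  + exact (smooth_derive_x V g Hg n).
- apply (ex_diff_n_mult V n Y (fun x y => Derive (fun v => g x v) y) hV).
  + apply HY.
  + exact (smooth_derive_y V g Hg n).
Qed.

Lemma smooth_lie_iter_h V X Y n :
  open_2d V -> smooth_on V X -> smooth_on V Y -> smooth_on V (lie_iter_h X Y n).
Proof.
intros hV HX HY. induction n as [|n IH].
- apply smooth_snd.
- now apply smooth_lie.
Qed.

Lemma continuous_along (f : R -> R -> R) (u v : R -> R) (t : R) :
  continuity_2d_pt f (u t) (v t) -> continuous u t -> continuous v t ->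
  continuous (fun z => f (u z) (v z)) t.
Proof.
intros Hf Hu Hv. apply (continuous_comp_2 u v f); trivial.
intros P HP. apply continuity_2d_pt_filterlim in Hf. exact (Hf P HP).
Qed.

Lemma derive_along V (f : R -> R -> R) (u v : R -> R) (t du dv : R) :
  open_2d V ->
  smooth_on V f -> V (u t) (v t) -> is_derive u t du -> is_derive v t dv ->
  is_derive (fun z => f (u z) (v z)) t
    (Derive (fun z => f z (v t)) (u t) * du + Derive (fun z => f (u t) z) (v t) * dv).
Proof.
intros hV Hf HV Hu Hv. apply is_derive_Reals.
apply derivable_pt_lim_comp_2d; [|now apply is_derive_Reals | now apply is_derive_Reals].
apply filterdiff_differentiable_pt_lim.
eapply filterdiff_ext_lin.
- apply (is_derive_filterdiff f (u t) (v t) (fun x y => Derive (fun z => f z y) x)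
           (Derive (fun z => f (u t) z) (v t))).
  + apply (proj1 (locally_2d_locally
      (fun x y => is_derive (fun z => f z y) x (Derive (fun z => f z y) x)) (u t) (v t))).
    apply locally_2d_on with V; trivial. intros x y Hxy.
    apply Derive_correct. eapply smooth_ex_derive_x; eassumption.
  + apply Derive_correct. eapply smooth_ex_derive_y; eassumption.
  + apply (proj1 (continuity_2d_pt_filterlim (fun x y => Derive (fun z => f z y) x) _ _)).
    apply (smooth_continuous _ _ _ _ (smooth_derive_x _ _ Hf) HV).
- intros [a b]. reflexivity.
Qed.

(** * The slope graph through an invisible contact *)

(** When [s * w < 0], the sign of [c * s * q t] is opposite to that of [t],
    because [x] has the sign of [c]; integrating once more, the change of sign
    of [q] at [0] gives [p] the sign of [w] on both sides. *)
Lemma sign_two_steps (s c rho : R) (p q w x : R -> R) :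
  (forall t, Rabs t < rho ->
     0 < x t * c /\ is_derive p t (q t / x t) /\ is_derive q t (w t / x t)) ->
  p 0 = 0 -> q 0 = 0 ->
  (forall t, 0 < Rabs t < rho -> s * w t < 0) ->
  forall t, 0 < Rabs t < rho -> s * p t < 0.
Proof.
intros H p0 q0 Hw.
(* Only the sign of [b * c'] is known, so quotients by [b] are rewritten with
   it as denominator. *)
assert (Hdiv : forall a b c', 0 < b * c' -> a / b = a * c' * / (b * c')).
{ intros a b c' Hb. field. split; intros E; rewrite E in Hb; lra. }
assert (Hq : forall t, 0 < Rabs t < rho -> t * (s * c * q t) < 0).
{ intros t Ht.
  assert (t <> 0) by (intros E; rewrite E, Rabs_R0 in Ht; lra).
  destruct (mean_value_from_0 q (fun z => w z / x z) t) as [e [He [Het Hel]]]; trivial.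
  { intros z Hz. apply H. lra. }
  assert (He0 : e <> 0) by (intros E; rewrite E in Het; lra).
  assert (Hwe : s * w e < 0) by (apply Hw; split; [now apply Rabs_pos_lt | lra]).
  destruct (H e ltac:(lra)) as [Hx _].
  rewrite (Hdiv (w e) (x e) c Hx) in He.
  pose proof (Rinv_0_lt_compat _ Hx) as Hi.
  replace (q t) with (w e * c * / (x e * c) * t) by lra.
  replace (t * (s * c * (w e * c * / (x e * c) * t))) with
    ((t * t) * ((s * w e) * ((c * c) * / (x e * c)))) by ring.
  assert (c <> 0) by (intros E; rewrite E in Hx; lra).
  assert (0 < (c * c) * / (x e * c)) by (apply Rmult_lt_0_compat; [nra|lra]).
  assert (0 < t * t) by nra.
  set (d := c * c * / (x e * c)) in *. assert (s * w e * d < 0) by nra. nra. }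
intros t Ht.
assert (t <> 0) by (intros E; rewrite E, Rabs_R0 in Ht; lra).
destruct (mean_value_from_0 p (fun z => q z / x z) t) as [e [He [Het Hel]]]; trivial.
{ intros z Hz. apply H. lra. }
assert (He0 : e <> 0) by (intros E; rewrite E in Het; lra).
assert (Hqe : e * (s * c * q e) < 0) by (apply Hq; split; [now apply Rabs_pos_lt | lra]).
destruct (H e ltac:(lra)) as [Hx _].
rewrite (Hdiv (q e) (x e) c Hx) in He.
pose proof (Rinv_0_lt_compat _ Hx) as Hi.
assert (Hqt : s * c * q e * t < 0).
{ apply Rnot_le_lt. intros Hle.
  assert (0 <= (s * c * q e * t) * (e * e)) by nra.
  assert (e * (s * c * q e) * (e * t) < 0) by nra. nra. }
replace (s * p t) with ((s * c * q e * t) * / (x e * c)).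
- nra.
- replace (p t) with (q e * c * / (x e * c) * t) by lra. ring.
Qed.

Definition slope_graph (V : R -> R -> Prop) (X Y : R -> R -> R) (a r : R)
    (g : R -> R) : Prop :=
  g a = 0 /\
  forall x, Rabs (x - a) < r ->
    V x (g x) /\ X x (g x) <> 0 /\ is_derive g x (Y x (g x) / X x (g x)).

(** On the graph, the derivative of [F^i h] is [F^(i+1) h / X], because the graph
    is a reparametrised trajectory.  The even multiplicity makes [sign_two_steps]
    reach [h], whose value on the graph is [g]. *)
Lemma invisible_contact_graph V X Y s k r g :
  open_2d V -> smooth_on V X -> smooth_on V Y ->
  0 < r -> slope_graph V X Y 0 r g -> invisible_contact s X Y k ->
  exists rho, 0 < rho /\ forall x, 0 < Rabs x < rho -> s * g x < 0.
Proof.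
intros hV hX hY hr [g0 Hg] [Hz Hs].
set (h := fun i x => lie_iter_h X Y i x (g x)).
assert (Hg' : forall x, Rabs x < r ->
  V x (g x) /\ X x (g x) <> 0 /\ is_derive g x (Y x (g x) / X x (g x))).
{ intros x Hx. apply Hg. now rewrite Rminus_0_r. }
assert (Hr0 : Rabs 0 < r) by now rewrite Rabs_R0.
assert (Hh : forall i x, Rabs x < r -> is_derive (h i) x (h (S i) x / X x (g x))).
{ intros i x Hx. destruct (Hg' x Hx) as [HV [HX Hd]].
  evar_last.
  - apply (derive_along V (lie_iter_h X Y i) (fun z => z) g x 1 (Y x (g x) / X x (g x)));
      trivial; [now apply smooth_lie_iter_h | apply (is_derive_id (K := R_AbsRing))].
  - unfold h. simpl. unfold lie at 1. now field. }
assert (Hcont : forall f, smooth_on V f -> continuous (fun x => f x (g x)) 0).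
{ intros f Hf. destruct (Hg' 0 Hr0) as [HV [HX Hd]].
  apply (continuous_along f (fun z => z) g).
  - now apply smooth_continuous with V.
  - apply continuous_id.
  - now apply is_derive_continuous in Hd. }
destruct (continuous_pos (fun x => - (s * h (2 * k)%nat x)) 0) as [d1 [Hd1 Hw]].
{ apply (continuous_opp (fun x => s * h (2 * k)%nat x)).
  apply (continuous_scal_r s (h (2 * k)%nat)). apply Hcont. now apply smooth_lie_iter_h. }
{ unfold h. rewrite g0. lra. }
destruct (continuous_pos (fun x => X x (g x) * X 0 0) 0) as [d2 [Hd2 HX]].
{ apply (continuous_mult (fun x => X x (g x)) (fun _ => X 0 0)); [now apply Hcont|].
  apply continuous_const. }
{ destruct (Hg' 0 Hr0) as [_ [HX _]]. rewrite g0 in *. nra. }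
set (rho := Rmin r (Rmin d1 d2)).
assert (Hrho : rho <= r /\ rho <= d1 /\ rho <= d2).
{ unfold rho. pose proof (Rmin_l r (Rmin d1 d2)). pose proof (Rmin_r r (Rmin d1 d2)).
  pose proof (Rmin_l d1 d2). pose proof (Rmin_r d1 d2). lra. }
exists rho. split; [unfold rho; repeat apply Rmin_pos; lra|].
assert (Hzero : forall i, (i <= 2 * k - 1)%nat -> h i 0 = 0).
{ intros [|i] Hi; unfold h; rewrite g0; [reflexivity|]. apply Hz. lia. }
assert (Hall : forall j, (j <= k)%nat ->
  forall x, 0 < Rabs x < rho -> s * h (2 * (k - j))%nat x < 0).
{ induction j as [|j IH]; intros Hj.
  - intros x Hx. rewrite Nat.sub_0_r.
    specialize (Hw x). rewrite Rminus_0_r in Hw. specialize (Hw ltac:(lra)). cbv beta in Hw. lra.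
  - apply (sign_two_steps s (X 0 0) rho (h (2 * (k - S j))%nat) (h (S (2 * (k - S j))))
      (h (2 * (k - j))%nat) (fun x => X x (g x))).
    + intros t Ht. split; [apply HX; rewrite Rminus_0_r; lra|].
      split; [apply Hh; lra|].
      replace (2 * (k - j))%nat with (S (S (2 * (k - S j)))) by lia. apply Hh; lra.
    + apply Hzero. lia.
    + apply Hzero. lia.
    + apply IH. lia. }
intros x Hx. specialize (Hall k (le_n k) x Hx). now rewrite Nat.sub_diag in Hall.
Qed.

(** * Slope graphs near the contact *)

(** One constant [L] bounds the field, bounds the slope, and is a Lipschitz constant
    of the slope in [y]; the condition on [X] makes trajectories monotone in [x]
    in the direction given at the origin. *)
Definition slope_box (V : R -> R -> Prop) (X Y : R -> R -> R) (rho L : R) : Prop :=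
  forall x y, Rabs x < rho -> Rabs y < rho ->
    V x y /\ 0 < X x y * X 0 0 /\ Rabs (X x y) <= L /\ Rabs (Y x y / X x y) <= L /\
    forall y', Rabs y' < rho ->
      Rabs (Y x y / X x y - Y x y' / X x y') <= L * Rabs (y - y').

Lemma locally_2d_bounded f x y :
  continuity_2d_pt f x y ->
  locally_2d (fun u v => Rabs (f u v) <= Rabs (f x y) + 1) x y.
Proof.
intros H. destruct (H (mkposreal 1 Rlt_0_1)) as [d Hd]. exists d. intros u v Hu Hv.
specialize (Hd u v Hu Hv). simpl in Hd.
pose proof (Rabs_triang (f u v - f x y) (f x y)) as Ht.
replace (f u v - f x y + f x y) with (f u v) in Ht by ring. lra.
Qed.

(** Continuity at the origin of [X], [Y] and of their derivatives in [y] is enough: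
    it bounds them on a square, and keeps [X] away from [0] there. *)
Lemma slope_box_exists V X Y :
  open_2d V -> V 0 0 -> smooth_on V X -> smooth_on V Y -> X 0 0 <> 0 ->
  exists rho L, 0 < rho /\ 0 < L /\ slope_box V X Y rho L.
Proof.
intros hV hV0 hX hY hX0.
set (c := Rabs (X 0 0) / 2).
assert (Hc : 0 < c) by (unfold c; pose proof (Rabs_pos_lt _ hX0); lra).
set (Xy := fun x y => Derive (fun z => X x z) y).
set (Yy := fun x y => Derive (fun z => Y x z) y).
assert (HXlow : locally_2d (fun u v => c < Rabs (X u v) /\ 0 < X u v * X 0 0) 0 0).
{ destruct (smooth_continuous V X 0 0 hX hV0 (mkposreal c Hc)) as [d Hd].
  exists d. intros u v Hu Hv. specialize (Hd u v Hu Hv). simpl in Hd.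
  unfold c in *. revert Hd Hc. unfold Rabs. destruct (Rcase_abs (X 0 0)), (Rcase_abs (X u v)),
   (Rcase_abs (X u v - X 0 0)); intros; split; try lra; nra. }
pose proof (locally_2d_bounded _ _ _ (smooth_continuous _ _ _ _ hX hV0)) as H1.
pose proof (locally_2d_bounded _ _ _ (smooth_continuous _ _ _ _ hY hV0)) as H2.
pose proof (locally_2d_bounded _ _ _ (smooth_continuous _ _ _ _ (smooth_derive_y _ _ hX) hV0))
  as H3.
pose proof (locally_2d_bounded _ _ _ (smooth_continuous _ _ _ _ (smooth_derive_y _ _ hY) hV0))
  as H4.
cbv beta in H3, H4. fold (Xy 0 0) in H3. fold (Yy 0 0) in H4.
set (B := Rabs (X 0 0) + 1 + (Rabs (Y 0 0) + 1) + (Rabs (Xy 0 0) + 1) + (Rabs (Yy 0 0) + 1)).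
pose proof (Rabs_pos (X 0 0)). pose proof (Rabs_pos (Y 0 0)).
pose proof (Rabs_pos (Xy 0 0)). pose proof (Rabs_pos (Yy 0 0)).
assert (HB : 0 < B) by (unfold B; lra).
pose proof (locally_2d_and _ _ _ _ (hV 0 0 hV0) (locally_2d_and _ _ _ _ HXlow
  (locally_2d_and _ _ _ _ (locally_2d_and _ _ _ _ H1 H2)
                          (locally_2d_and _ _ _ _ H3 H4)))) as [d Hd].
pose proof (Rinv_0_lt_compat c Hc) as Hic.
set (L := B + B * / c + 2 * B * B * (/ c * / c)).
assert (Hp1 : 0 < B * / c) by nra.
assert (Hp2 : 0 < 2 * B * B * (/ c * / c)) by (apply Rmult_lt_0_compat; nra).
exists d, L. split; [apply cond_pos|]. split; [unfold L; lra|].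
assert (Hbox : forall x y, Rabs x < d -> Rabs y < d ->
  V x y /\ (c < Rabs (X x y) /\ 0 < X x y * X 0 0) /\ Rabs (X x y) <= B /\ Rabs (Y x y) <= B
  /\ Rabs (Xy x y) <= B /\ Rabs (Yy x y) <= B).
{ intros x y Hx Hy. destruct (Hd x y) as [K1 [K2 [[K3 K4] [K5 K6]]]];
    [now rewrite Rminus_0_r | now rewrite Rminus_0_r |].
  change (Rabs (Xy x y) <= Rabs (Xy 0 0) + 1) in K5.
  change (Rabs (Yy x y) <= Rabs (Yy 0 0) + 1) in K6.
  unfold B. repeat split; trivial; try apply K2; lra. }
assert (Hinv : forall z, c < Rabs z -> Rabs (/ z) <= / c).
{ intros z Hz. rewrite Rabs_inv. apply Rinv_le_contravar; lra. }
assert (Hn0 : forall z, c < Rabs z -> z <> 0).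
{ intros z Hz E. rewrite E, Rabs_R0 in Hz. lra. }
intros x y Hx Hy.
destruct (Hbox x y Hx Hy) as [K1 [[K2 K2'] [K3 [K4 [K5 K6]]]]].
split; [exact K1|]. split; [exact K2'|]. split; [unfold L; lra|]. split.
- unfold Rdiv. rewrite Rabs_mult. apply Rle_trans with (B * / c); [|unfold L; lra].
  apply Rmult_le_compat; auto using Rabs_pos.
- intros y' Hy'. destruct (Hbox x y' Hx Hy') as [J1 [[J2 J2'] [J3 [J4 _]]]].
  assert (LX : Rabs (X x y - X x y') <= B * Rabs (y - y')).
  { apply (lipschitz_of_derive (fun z => X x z) B d); trivial. intros z Hz.
    destruct (Hbox x z Hx Hz) as [M1 [_ [_ [_ [M _]]]]]. split; [|exact M].
    now apply smooth_ex_derive_y with V. }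
  assert (LY : Rabs (Y x y - Y x y') <= B * Rabs (y - y')).
  { apply (lipschitz_of_derive (fun z => Y x z) B d); trivial. intros z Hz.
    destruct (Hbox x z Hx Hz) as [M1 [_ [_ [_ [_ M]]]]]. split; [|exact M].
    now apply smooth_ex_derive_y with V. }
  replace (Y x y / X x y - Y x y' / X x y') with
    (((Y x y - Y x y') * X x y' + - (Y x y' * (X x y - X x y'))) * (/ X x y * / X x y'))
    by (field; auto).
  rewrite Rabs_mult, (Rabs_mult (/ _)).
  apply Rle_trans with ((2 * B * B * Rabs (y - y')) * (/ c * / c)).
  + apply Rmult_le_compat; [apply Rabs_pos | | |].
    * apply Rmult_le_pos; apply Rabs_pos.
    * eapply Rle_trans; [apply Rabs_triang|]. rewrite Rabs_Ropp, !Rabs_mult.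
      pose proof (Rabs_pos (y - y')).
      replace (2 * B * B * Rabs (y - y')) with
        ((B * Rabs (y - y')) * B + B * (B * Rabs (y - y'))) by ring.
      apply Rplus_le_compat; apply Rmult_le_compat; auto using Rabs_pos.
    * apply Rmult_le_compat; auto using Rabs_pos.
  + unfold L. pose proof (Rabs_pos (y - y')). nra.
Qed.

(** A slope bounded by [L] allows a rise of at most [L * (2 * r')] over the width
    of the box, so the graph cannot leave through its top or bottom. *)
Lemma slope_graph_flat V X Y rho L r r' a g :
  0 < L -> slope_box V X Y rho L -> slope_graph V X Y a r g ->
  r' < rho -> 2 * r' < r -> L * (2 * r') < rho -> Rabs a <= r' ->
  forall x, Rabs x <= r' -> Rabs (g x) < rho.
Proof.
intros hL hbox [ga Hg] Hr1 Hr2 Hr3 Ha.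
(* The sign [c] selects the direction in which the graph is followed from [a]. *)
assert (Hdir : forall c, c * c = 1 -> forall T, 0 <= T -> Rabs (a + c * T) <= r' ->
  Rabs (g (a + c * T)) < rho).
{ intros c Hc T HT HaT.
  assert (Hcc : c = 1 \/ c = -1).
  { assert (E : (c - 1) * (c + 1) = 0) by lra.
    apply Rmult_integral in E. lra. }
  assert (Hin : forall t, 0 <= t <= T -> Rabs (a + c * t) <= r').
  { intros t Ht. revert Ha HaT. unfold Rabs.
    destruct Hcc as [-> | ->];
    repeat match goal with |- context [Rcase_abs ?z] => destruct (Rcase_abs z) end; lra. }
  assert (Hin' : forall t, 0 <= t <= T -> Rabs (a + c * t - a) < r).
  { intros t Ht. pose proof (Rabs_triang (a + c * t) (- a)) as Q.
    rewrite Rabs_Ropp in Q. specialize (Hin t Ht). unfold Rminus. lra. }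
  assert (HT2 : T <= 2 * r').
  { specialize (Hin T (conj HT (Rle_refl T))). revert Ha Hin. unfold Rabs.
    destruct Hcc as [-> | ->];
    repeat match goal with |- context [Rcase_abs ?z] => destruct (Rcase_abs z) end; lra. }
  set (psi := fun t => g (a + c * t)).
  assert (Hpsi : forall t, 0 <= t <= T ->
    is_derive psi t (c * (Y (a + c * t) (psi t) / X (a + c * t) (psi t)))).
  { intros t Ht. destruct (Hg _ (Hin' t Ht)) as [_ [_ D]].
    evar_last.
    - apply (is_derive_comp g (fun t => a + c * t) t _ c D). auto_derive; [exact I|ring].
    - reflexivity. }
  apply (interval_induction 0 T (fun t => Rabs (psi t) < rho)); [| |lra].
  - intros t Ht HP.
    assert (Hcont : continuous (fun t => Rabs (psi t)) t).
    { apply continuous_comp; [|apply continuous_Rabs].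
      eapply is_derive_continuous. now apply Hpsi. }
    apply (Hcont (fun y => y < rho)). now apply open_lt.
  - intros t Ht HP.
    destruct (Rle_lt_or_eq_dec 0 t ltac:(lra)) as [Hlt| <- ].
    + destruct (MVT_cor2 psi (fun t => c * (Y (a + c * t) (psi t) / X (a + c * t) (psi t)))
        0 t Hlt) as [e [E He]].
      { intros e He. apply is_derive_Reals, Hpsi. lra. }
      destruct (hbox (a + c * e) (psi e)) as [_ [_ [_ [HL _]]]].
      { specialize (Hin e ltac:(lra)). lra. }
      { apply HP. lra. }
      assert (E0 : psi 0 = 0) by (unfold psi; rewrite Rmult_0_r, Rplus_0_r; exact ga).
      rewrite E0, !Rminus_0_r in E. rewrite E, !Rabs_mult.
      assert (Rabs c = 1) as -> by (unfold Rabs; destruct (Rcase_abs c); lra).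
      rewrite Rmult_1_l, (Rabs_pos_eq t) by lra.
      apply Rle_lt_trans with (L * (2 * r')); [|exact Hr3].
      apply Rmult_le_compat; try lra. apply Rabs_pos.
    + unfold psi. rewrite Rmult_0_r, Rplus_0_r, ga, Rabs_R0.
      assert (0 <= r') by (pose proof (Rabs_pos a); lra). nra. }
intros x Hx. destruct (Rle_lt_dec a x).
- replace x with (a + 1 * (x - a)) in * by ring. apply Hdir; lra.
- replace x with (a + -1 * (a - x)) in * by ring. apply Hdir; lra.
Qed.

(** Continuous dependence on the initial point, by Gronwall's inequality. *)
Lemma slope_graph_close V X Y rho L r' a g1 g2 :
  slope_box V X Y rho L -> r' < rho -> 0 <= L ->
  (forall x, Rabs x <= r' -> Rabs (g1 x) < rho /\ is_derive g1 x (Y x (g1 x) / X x (g1 x))) ->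
  (forall x, Rabs x <= r' -> Rabs (g2 x) < rho /\ is_derive g2 x (Y x (g2 x) / X x (g2 x))) ->
  Rabs a <= r' -> forall x, Rabs x <= r' ->
  Rabs (g1 x - g2 x) <= Rabs (g1 a - g2 a) * exp (L * (2 * r')).
Proof.
intros hbox Hr hL H1 H2 Ha x Hx.
eapply Rle_trans.
- apply (gronwall L (fun t => g1 t - g2 t)
    (fun t => Y t (g1 t) / X t (g1 t) - Y t (g2 t) / X t (g2 t)) a x).
  intros t Ht.
  assert (Htr : Rabs t <= r').
  { apply Rabs_le. apply Rabs_le_between in Ha, Hx. revert Ht. unfold Rmin, Rmax.
    destruct (Rle_dec a x); lra. }
  destruct (H1 t Htr) as [B1 D1], (H2 t Htr) as [B2 D2]. split.
  + apply (is_derive_minus (K := R_AbsRing) g1 g2); assumption.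
  + destruct (hbox t (g1 t)) as [_ [_ [_ [_ HL]]]]; [lra | exact B1 |]. now apply HL.
- apply Rmult_le_compat_l; [apply Rabs_pos|].
  assert (Rabs (x - a) <= 2 * r').
  { pose proof (Rabs_triang x (- a)) as Q. rewrite Rabs_Ropp in Q. unfold Rminus. lra. }
  assert (Hle : L * Rabs (x - a) <= L * (2 * r')) by (apply Rmult_le_compat_l; lra).
  destruct Hle as [Hlt| -> ]; [left; now apply exp_increasing | right; reflexivity].
Qed.

(** * Arcs starting or ending near the contact *)

(** What an arc from [(a, 0)] to [(b, 0)] of duration [tau] amounts to on the slope
    graph [g] through its starting point: [b] is the first zero of [g] in the
    direction of the field, and [tau] is the integral of [1 / X (x, g x)] from [a]
    to [b].  The integral is rescaled to the unit interval as in [half_time], and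
    stated as [is_RInt] so that integrability is part of it. *)
Definition returns_along (s : R) (X : R -> R -> R) (g : R -> R) (a b tau rho : R) : Prop :=
  Rabs b < rho /\ 0 < X 0 0 * (b - a) /\ g b = 0 /\
  (forall x, 0 < (x - a) * (b - x) -> 0 < s * g x) /\
  is_RInt (fun p => 1 / X (a + (b - a) * p) (g (a + (b - a) * p))) 0 1 (tau / (b - a)).

(** Gronwall's inequality for [v - g u], whose derivative is [X] times the difference of
    the slopes at the heights [v] and [g u]. *)
Lemma trajectory_on_graph V X Y rho rho1 L r' (g u v : R -> R) t :
  slope_box V X Y rho L -> rho1 < rho -> r' < rho ->
  (forall x, Rabs x <= r' -> Rabs (g x) < rho1 /\ is_derive g x (Y x (g x) / X x (g x))) ->
  0 <= t -> v 0 = g (u 0) ->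
  (forall z, 0 <= z <= t ->
     is_derive u z (X (u z) (v z)) /\ is_derive v z (Y (u z) (v z)) /\
     Rabs (u z) <= r' /\ Rabs (v z) <= rho1) ->
  v t = g (u t).
Proof.
intros hbox hrho hr hg Ht Hv0 H.
assert (Hw : Rabs (v t - g (u t)) <= Rabs (v 0 - g (u 0)) * exp (L * L * (t - 0))).
{ apply (gronwall_forward (L * L) (fun z => v z - g (u z))
   (fun z => Y (u z) (v z) - X (u z) (v z) * (Y (u z) (g (u z)) / X (u z) (g (u z)))));
    [lra|].
  intros z Hz. destruct (H z Hz) as [Du [Dv [Bu Bv]]]. destruct (hg (u z) Bu) as [Bg Dg].
  destruct (hbox (u z) (v z)) as [_ [HX0 [HXL [_ Hlip]]]]; [lra|lra|].
  specialize (Hlip (g (u z)) ltac:(lra)). split.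
  - apply (is_derive_minus (K := R_AbsRing) v (fun z => g (u z))); [exact Dv|].
    exact (is_derive_comp g u z _ _ Dg Du).
  - set (q := Y (u z) (g (u z)) / X (u z) (g (u z))) in *.
    replace (Y (u z) (v z) - X (u z) (v z) * q) with
      (X (u z) (v z) * (Y (u z) (v z) / X (u z) (v z) - q)).
    + rewrite Rabs_mult, Rmult_assoc.
      apply Rmult_le_compat; auto using Rabs_pos.
    + field. intros E. rewrite E in HX0. lra. }
rewrite Hv0, Rminus_diag, Rabs_R0, Rmult_0_l in Hw.
pose proof (Rabs_pos (v t - g (u t))).
assert (Z : Rabs (v t - g (u t)) = 0) by lra. apply Rabs_eq_0 in Z. lra.
Qed.

(** The graph [g] is on the wrong side of the axis at [r'] and at [- r'], so the arc,
    which follows it, cannot reach these abscissas while [s * v >= 0]; and it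
    cannot leave through the top or bottom of the box since [g] is flat there. *)
Lemma arc_returns_along V X Y s rho rho1 L r' a b tau g :
  (forall x y, V x y -> continuity_2d_pt X x y) ->
  slope_box V X Y rho L -> rho1 < rho -> r' < rho -> Rabs a < r' ->
  g a = 0 ->
  (forall x, Rabs x <= r' -> Rabs (g x) < rho1 /\ is_derive g x (Y x (g x) / X x (g x))) ->
  s * g r' < 0 -> s * g (- r') < 0 ->
  arc s V X Y a b tau ->
  returns_along s X g a b tau r'.
Proof.
intros hX hbox hrho hr ha ga hg hR hL' [Htau [u [v [u0 [v0 [u1 [v1 [Huv Hs]]]]]]]].
assert (Hcu : forall t, 0 <= t <= tau -> continuous u t).
{ intros t Ht. eapply is_derive_continuous. now apply Huv. }
assert (Hcv : forall t, 0 <= t <= tau -> continuous v t).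
{ intros t Ht. eapply is_derive_continuous. now apply Huv. }
assert (Hcomp : forall (f : R -> R) (t : R), continuous f t -> continuous (fun z => Rabs (f z)) t).
{ intros f t Hf. apply continuous_comp; [exact Hf | apply continuous_Rabs]. }
assert (Hgraph : forall t, 0 <= t <= tau ->
  (forall t', 0 <= t' <= t -> Rabs (u t') <= r' /\ Rabs (v t') <= rho1) -> v t = g (u t)).
{ intros t Ht Hin.
  apply (trajectory_on_graph V X Y rho rho1 L r' g u v t); trivial; [lra | |].
  - rewrite u0, v0. now symmetry.
  - intros z Hz. destruct (Huv z ltac:(lra)) as [_ HD], (Hin z Hz). tauto. }
assert (Hrho1 : 0 < rho1).
{ destruct (hg a ltac:(lra)) as [Hb _]. rewrite ga, Rabs_R0 in Hb. exact Hb. }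
(* On the right-closed interval the arc is in the closed box, where it still
   follows [g]; this excludes [Rabs (u t) = r']. *)
assert (Hstay : forall t, 0 <= t <= tau -> Rabs (u t) < r' /\ Rabs (v t) < rho1).
{ apply (interval_induction 0 tau (fun t => Rabs (u t) < r' /\ Rabs (v t) < rho1)).
  - intros t Ht [Hu Hv]. apply filter_and.
    + exact (Hcomp u t (Hcu t Ht) (fun y => y < r') (open_lt _ _ Hu)).
    + exact (Hcomp v t (Hcv t Ht) (fun y => y < rho1) (open_lt _ _ Hv)).
  - intros t Ht Hin.
    destruct (Rle_lt_or_eq_dec 0 t ltac:(lra)) as [Hlt| <- ];
      [|rewrite u0, v0, Rabs_R0; split; assumption].
    assert (Hle : Rabs (u t) <= r' /\ Rabs (v t) <= rho1).
    { split; [apply (le_of_left_limit (fun z => Rabs (u z)) r' t Hlt)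
             |apply (le_of_left_limit (fun z => Rabs (v z)) rho1 t Hlt)]; auto;
      intros t' Ht'; left; now apply Hin. }
    assert (Hv : v t = g (u t)).
    { apply Hgraph; [exact Ht|]. intros t' Ht'.
      destruct (Rle_lt_or_eq_dec t' t ltac:(lra)) as [H| -> ]; [|exact Hle].
      destruct (Hin t' ltac:(lra)); lra. }
    split; [|rewrite Hv; now apply hg].
    assert (Hsv : 0 <= s * v t).
    { destruct (Rle_lt_or_eq_dec t tau ltac:(lra)) as [H| -> ].
      - left. apply Hs. lra.
      - rewrite v1. lra. }
    destruct Hle as [[H|H] _]; [exact H|exfalso].
    revert H. unfold Rabs. destruct (Rcase_abs (u t)); intros H.
    + replace (u t) with (- r') in Hv by lra. rewrite Hv in Hsv. lra.
    + rewrite H in Hv. rewrite Hv in Hsv. lra. }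
assert (Hv : forall t, 0 <= t <= tau -> v t = g (u t)).
{ intros t Ht. apply Hgraph; [exact Ht|]. intros t' Ht'.
  destruct (Hstay t' ltac:(lra)). lra. }
assert (HX0 : forall t, 0 <= t <= tau -> 0 < X (u t) (v t) * X 0 0).
{ intros t Ht. destruct (Hstay t Ht). apply hbox; lra. }
assert (Hb : Rabs b < r') by (rewrite <- u1; apply Hstay; lra).
assert (Hab : 0 < X 0 0 * (b - a)).
{ destruct (MVT_cor2 u (fun t => X (u t) (v t)) 0 tau Htau) as [c [Hc Hct]].
  { intros c Hc. apply is_derive_Reals. now apply Huv. }
  specialize (HX0 c ltac:(lra)). rewrite u1, u0 in Hc. rewrite Hc, Rminus_0_r. nra. }
assert (Hba : b - a <> 0) by (intros E; rewrite E in Hab; lra).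
split; [exact Hb|]. split; [exact Hab|].
split; [rewrite <- u1, <- Hv by lra; exact v1|].
split.
- intros x Hx.
  assert (Hxa : X 0 0 * (a - x) < 0 < X 0 0 * (b - x)).
  { assert (0 < (x - a) / (b - a) * ((b - x) / (b - a))).
    { replace ((x - a) / (b - a) * ((b - x) / (b - a))) with
        ((x - a) * (b - x) * (/ (b - a) * / (b - a))) by now field.
      apply Rmult_lt_0_compat; [exact Hx|]. pose proof (Rinv_neq_0_compat _ Hba). nra. }
    set (p := (x - a) / (b - a)) in *.
    replace ((b - x) / (b - a)) with (1 - p) in H by (unfold p; now field).
    assert (0 < p < 1) by nra.
    replace (a - x) with (- p * (b - a)) by (unfold p; now field).
    replace (b - x) with ((1 - p) * (b - a)) by (unfold p; now field).
    split; nra. }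
  destruct (IVT_interv (fun t => X 0 0 * (u t - x)) 0 tau) as [t [Ht Et]].
  + intros t Ht. apply continuity_pt_filterlim.
    apply (continuous_scal_r (X 0 0) (fun t => u t - x)).
    apply (continuous_minus u (fun _ => x)); [now apply Hcu | apply continuous_const].
  + exact Htau.
  + rewrite u0. lra.
  + rewrite u1. lra.
  + assert (Hut : u t = x).
    { apply Rmult_integral in Et. destruct Et as [E|E]; [rewrite E in Hab; lra | lra]. }
    rewrite <- Hut, <- Hv by lra. apply Hs.
    split; apply Rnot_le_lt; intros Hle.
    * replace t with 0 in Hut by lra. rewrite u0 in Hut. rewrite Hut in Hxa. lra.
    * replace t with tau in Hut by lra. rewrite u1 in Hut. rewrite Hut in Hxa. lra.
(* Substitute [p = (u t - a) / (b - a)]: since [u' = X (u, g u)], the integrand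
   becomes the constant [/ (b - a)] on [0, tau]. *)
- set (F := fun p => 1 / X (a + (b - a) * p) (g (a + (b - a) * p))).
  assert (HF : forall p, Rabs (a + (b - a) * p) < r' -> continuous F p).
  { intros p Hp. destruct (hg _ (Rlt_le _ _ Hp)) as [Bg Dg].
    destruct (hbox (a + (b - a) * p) (g (a + (b - a) * p))) as [HV [HXp _]]; [lra|lra|].
    assert (Hlin : continuous (fun p => a + (b - a) * p) p).
    { apply is_derive_continuous with (b - a). auto_derive; [exact I|ring]. }
    assert (HC : continuous (fun p => X (a + (b - a) * p) (g (a + (b - a) * p))) p).
    { apply (continuous_along X (fun p => a + (b - a) * p) (fun p => g (a + (b - a) * p)));
        [now apply hX | exact Hlin |].
      apply (continuous_comp (fun p => a + (b - a) * p) g); [exact Hlin|].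
      eapply is_derive_continuous, Dg. }
    apply (continuous_mult (fun _ => 1)
      (fun p => / X (a + (b - a) * p) (g (a + (b - a) * p)))); [apply continuous_const|].
    apply continuous_Rinv_comp; [exact HC|].
    intros E. rewrite E in HXp. lra. }
  assert (Hint : ex_RInt F 0 1).
  { apply (ex_RInt_continuous (V := R_CompleteNormedModule)).
    rewrite Rmin_left, Rmax_right by lra. intros p Hp. apply HF.
    apply Rabs_def2 in ha, Hb. apply Rabs_def1; nra. }
  replace (tau / (b - a)) with (RInt F 0 1);
    [now apply (RInt_correct (V := R_CompleteNormedModule) F)|].
  pose proof (RInt_comp F (fun t => (u t - a) / (b - a)) (fun t => X (u t) (v t) / (b - a)) 0 tau)
    as HI.
  cbv beta in HI. rewrite u0, u1 in HI.
  replace ((a - a) / (b - a)) with 0 in HI by now field.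
  replace ((b - a) / (b - a)) with 1 in HI by now field.
  rewrite Rmin_left, Rmax_right in HI by lra.
  assert (Hlin : forall t, a + (b - a) * ((u t - a) / (b - a)) = u t) by (intros t; now field).
  rewrite <- HI.
  + rewrite (RInt_ext _ (fun _ => / (b - a))).
    * rewrite RInt_const. unfold scal; simpl; unfold mult; simpl. unfold Rdiv. ring.
    * rewrite Rmin_left, Rmax_right by lra. intros t Ht.
      unfold scal; simpl; unfold mult; simpl. unfold F.
      rewrite Hlin, <- Hv by lra. specialize (HX0 t ltac:(lra)). field.
      split; [exact Hba|]. intros E. rewrite E in HX0. lra.
  + intros t Ht. apply HF. rewrite Hlin. now apply Hstay.
  + intros t Ht. destruct (Huv t Ht) as [HV [Du Dv]]. split.
    * assert (He : ex_derive u t) by (eexists; exact Du).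
      auto_derive; [exact He|]. change (fun x => u x) with u.
      rewrite (is_derive_unique _ _ _ Du). now field.
    * apply (continuous_mult (fun t => X (u t) (v t)) (fun _ => / (b - a)));
        [|apply continuous_const].
      apply continuous_along; auto.
Qed.

Lemma arc_reverse s V X Y a b tau :
  arc s V X Y a b tau -> arc s V (fun x y => - X x y) (fun x y => - Y x y) b a tau.
Proof.
intros [Htau [u [v [u0 [v0 [u1 [v1 [Huv Hs]]]]]]]]. split; [exact Htau|].
exists (fun t => u (tau - t)), (fun t => v (tau - t)).
rewrite !Rminus_0_r, !Rminus_diag. do 4 (split; [assumption|]).
split; [intros t Ht; split; [apply Huv; lra | split]|].
- destruct (Huv (tau - t) ltac:(lra)) as [_ [Du _]].
  evar_last.
  { apply (is_derive_comp u (fun t => tau - t) t _ (-1) Du). auto_derive; [exact I|ring]. }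
  unfold scal; simpl; unfold mult; simpl; ring.
- destruct (Huv (tau - t) ltac:(lra)) as [_ [_ Dv]].
  evar_last.
  { apply (is_derive_comp v (fun t => tau - t) t _ (-1) Dv). auto_derive; [exact I|ring]. }
  unfold scal; simpl; unfold mult; simpl; ring.
- intros t Ht. apply Hs. lra.
Qed.

Lemma quotient_opp x y : - y / - x = y / x.
Proof. unfold Rdiv. rewrite Rinv_opp. ring. Qed.

Lemma slope_box_opp V X Y rho L :
  slope_box V X Y rho L -> slope_box V (fun x y => - X x y) (fun x y => - Y x y) rho L.
Proof.
intros H x y Hx Hy. destruct (H x y Hx Hy) as [H1 [H2 [H3 [H4 H5]]]].
rewrite Rabs_Ropp, quotient_opp. repeat split; trivial; [lra|].
intros y' Hy'. rewrite quotient_opp. now apply H5.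
Qed.

Definition arcs_return_along (s : R) (V : R -> R -> Prop) (X Y : R -> R -> R)
    (G : R -> R -> R) (eps rho : R) : Prop :=
  forall a, Rabs a < eps ->
    (forall b tau, arc s V X Y a b tau -> returns_along s X (G a) a b tau rho) /\
    (forall b tau, arc s V X Y b a tau ->
       returns_along s (fun x y => - X x y) (G a) a b tau rho).

(** The graph through the origin is strictly on the wrong side of the axis at [r'] and
    [- r'] by invisibility, and this margin fixes how small [a] must be for the
    graph through [(a, 0)] to be there too. *)
Lemma arcs_near_contact V X Y s k r G eta :
  open_2d V -> V 0 0 -> smooth_on V X -> smooth_on V Y ->
  0 < r -> (forall a, Rabs a < r -> slope_graph V X Y a r (G a)) ->
  invisible_contact s X Y k -> 0 < eta ->
  exists eps, 0 < eps /\ arcs_return_along s V X Y G eps eta.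
Proof.
intros hV hV0 hX hY hr hG hinv heta.
assert (Hr0 : Rabs 0 < r) by now rewrite Rabs_R0.
assert (hX0 : X 0 0 <> 0).
{ destruct (hG 0 Hr0) as [G0 H0]. destruct (H0 0) as [_ [HX _]].
  - now rewrite Rminus_0_r.
  - now rewrite G0 in HX. }
destruct (slope_box_exists V X Y hV hV0 hX hY hX0) as [rho [L [Hrho [HL hbox]]]].
destruct (invisible_contact_graph V X Y s k r (G 0) hV hX hY hr (hG 0 Hr0) hinv)
  as [d [Hd Hneg]].
assert (Hr' : exists r', 0 < r' /\ r' <= eta /\ r' < d /\ 2 * r' < r /\
                r' < rho / 2 /\ L * (2 * r') < rho / 2).
{ assert (0 < rho / (8 * L)) by (apply Rdiv_lt_0_compat; lra).
  exists (Rmin (Rmin eta (d / 2)) (Rmin (r / 4) (Rmin (rho / 4) (rho / (8 * L))))).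
  set (m1 := Rmin eta (d / 2)). set (m2 := Rmin (rho / 4) (rho / (8 * L))).
  set (m3 := Rmin (r / 4) m2).
  pose proof (Rmin_l eta (d / 2)). pose proof (Rmin_r eta (d / 2)).
  pose proof (Rmin_l (rho / 4) (rho / (8 * L))). pose proof (Rmin_r (rho / 4) (rho / (8 * L))).
  pose proof (Rmin_l (r / 4) m2). pose proof (Rmin_r (r / 4) m2).
  pose proof (Rmin_l m1 m3). pose proof (Rmin_r m1 m3).
  fold m1 in H0, H1. fold m2 in H2, H3. fold m3 in H4, H5.
  split; [unfold m1, m3, m2; repeat apply Rmin_pos; lra|].
  repeat split; try lra.
  apply Rle_lt_trans with (L * (2 * (rho / (8 * L)))).
  - apply Rmult_le_compat_l; lra.
  - replace (L * (2 * (rho / (8 * L)))) with (rho / 4) by (field; lra). lra. }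
destruct Hr' as [r' [Hr1 [Hr2 [Hr3 [Hr4 [Hr5 Hr6]]]]]].
assert (hbox2 : slope_box V X Y (rho / 2) L).
{ intros x y Hx Hy. destruct (hbox x y) as [K1 [K2 [K3 [K4 K5]]]]; [lra|lra|].
  repeat split; trivial. intros y' Hy'. apply K5. lra. }
assert (Hgraph : forall a, Rabs a <= r' -> forall x, Rabs x <= r' ->
  Rabs (G a x) < rho / 2 /\ is_derive (G a) x (Y x (G a x) / X x (G a x))).
{ intros a Ha x Hx. split.
  - apply (slope_graph_flat V X Y (rho / 2) L r r' a); trivial. apply hG. lra.
  - apply (hG a ltac:(lra)). pose proof (Rabs_triang x (- a)) as Q.
    rewrite Rabs_Ropp in Q. unfold Rminus. lra. }
assert (Hr'p : Rabs r' = r') by (apply Rabs_pos_eq; lra).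
assert (Hr'n : Rabs (- r') = r') by now rewrite Rabs_Ropp.
pose proof (Hneg r' ltac:(lra)) as Hn1.
pose proof (Hneg (- r') ltac:(lra)) as Hn2.
set (m := Rmin (Rabs (G 0 r')) (Rabs (G 0 (- r')))).
assert (Hm : 0 < m).
{ apply Rmin_pos; apply Rabs_pos_lt; intros E; rewrite E in *; lra. }
set (e := exp (L * (2 * r'))).
assert (He : 0 < e) by apply exp_pos.
assert (G0 : G 0 0 = 0) by apply (hG 0 Hr0).
assert (Hcont : exists d0, 0 < d0 /\ forall a, Rabs a < d0 -> Rabs (G 0 a) < m / e).
{ destruct (Hgraph 0 ltac:(rewrite Rabs_R0; lra) 0 ltac:(rewrite Rabs_R0; lra)) as [_ D].
  apply is_derive_continuous in D.
  assert (Hc : continuous (fun z => Rabs (G 0 z)) 0)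
    by (apply continuous_comp; [exact D | apply continuous_Rabs]).
  assert (H0 : Rabs (G 0 0) < m / e) by (rewrite G0, Rabs_R0; apply Rdiv_lt_0_compat; lra).
  destruct (locally_Rabs _ _ (Hc (fun y => y < m / e) (open_lt (m / e) _ H0)))
    as [d0 [Hd0 Hn]].
  exists d0. split; [exact Hd0|]. intros a Ha. apply Hn. now rewrite Rminus_0_r. }
destruct Hcont as [d0 [Hd0 Hsmall]].
exists (Rmin d0 r'). split; [now apply Rmin_pos|].
intros a Ha.
assert (Ha' : Rabs a < d0 /\ Rabs a < r').
{ pose proof (Rmin_l d0 r'). pose proof (Rmin_r d0 r'). lra. }
assert (ga : G a a = 0) by (apply (hG a); lra).
assert (Hclose : forall x, Rabs x <= r' -> Rabs (G a x - G 0 x) < m).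
{ intros x Hx. eapply Rle_lt_trans.
  - apply (slope_graph_close V X Y (rho / 2) L r' a (G a) (G 0)); trivial; try lra;
      apply Hgraph; rewrite ?Rabs_R0; lra.
  - rewrite ga, Rminus_0_l, Rabs_Ropp. fold e.
    destruct Ha' as [Ha1 _]. specialize (Hsmall a Ha1).
    replace m with (m / e * e) by (field; lra). apply Rmult_lt_compat_r; lra. }
assert (Hsign : forall x y, Rabs (x - y) < Rabs y -> s * y < 0 -> s * x < 0).
{ intros x y. unfold Rabs. destruct (Rcase_abs (x - y)), (Rcase_abs y); intros; nra. }
assert (Ho1 : s * G a r' < 0).
{ apply Hsign with (G 0 r'); trivial.
  apply Rlt_le_trans with m; [apply Hclose; lra | apply Rmin_l]. }
assert (Ho2 : s * G a (- r') < 0).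
{ apply Hsign with (G 0 (- r')); trivial.
  apply Rlt_le_trans with m; [apply Hclose; lra | apply Rmin_r]. }
assert (Hweak : forall X' b tau,
  returns_along s X' (G a) a b tau r' -> returns_along s X' (G a) a b tau eta).
{ intros X' b tau [H1 H2]. split; [lra|exact H2]. }
split; intros b tau Harc; apply Hweak.
- apply (arc_returns_along V X Y s rho (rho / 2) L r'); trivial; try lra.
  + intros x y Hxy. now apply smooth_continuous with V.
  + apply Hgraph. lra.
- apply (arc_returns_along V (fun x y => - X x y) (fun x y => - Y x y) s rho (rho / 2) L r');
    trivial; try lra.
  + intros x y Hxy. apply continuity_2d_pt_opp. now apply smooth_continuous with V.
  + now apply slope_box_opp.
  + intros x Hx. rewrite quotient_opp. apply Hgraph; lra.
  + now apply arc_reverse.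
Qed.

(** * The period function *)

(** Since [s * delta] is [1] or [-1], the change of variable [x = a + s * delta * t]
    is undone by [t = s * delta * (x - a)]. *)
Definition graph_through (s delta : R) (y : R -> R -> R) (a x : R) : R :=
  y (s * delta * (x - a)) a.

Lemma slope_solution_neq_0 s delta V X Y y :
  slope_solution s delta V X Y y -> X 0 0 <> 0.
Proof.
intros [r [Hr H]]. destruct (H 0) as [y0 H0]; [now rewrite Rabs_R0|].
destruct (H0 0) as [_ [HX _]]; [now rewrite Rabs_R0|].
now rewrite y0, Rmult_0_r, Rplus_0_r in HX.
Qed.

Lemma slope_solution_graphs s delta V X Y y :
  s * s = 1 -> delta * delta = 1 -> slope_solution s delta V X Y y ->
  exists r, 0 < r /\ forall a, Rabs a < r -> slope_graph V X Y a r (graph_through s delta y a).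
Proof.
intros Hs Hdelta [r [Hr H]]. exists r. split; [exact Hr|].
intros a Ha. destruct (H a Ha) as [y0 Hy].
assert (Hc2 : (s * delta) * (s * delta) = 1).
{ replace ((s * delta) * (s * delta)) with ((s * s) * (delta * delta)) by ring.
  rewrite Hs, Hdelta. ring. }
unfold graph_through, eta in *. set (c := s * delta) in *.
assert (Hc : Rabs c = 1).
{ assert (E : (c - 1) * (c + 1) = 0) by lra. apply Rmult_integral in E.
  unfold Rabs; destruct (Rcase_abs c); lra. }
split; [now rewrite Rminus_diag, Rmult_0_r|].
intros x Hx. destruct (Hy (c * (x - a))) as [HV [HX D]].
{ now rewrite Rabs_mult, Hc, Rmult_1_l. }
replace (a + c * (c * (x - a))) with x in * by
  (replace (c * (c * (x - a))) with ((c * c) * (x - a)) by ring; rewrite Hc2; ring).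
split; [exact HV|]. split; [exact HX|].
evar_last.
- apply (is_derive_comp (fun t => y t a) (fun x => c * (x - a)) x _ c D).
  auto_derive; [exact I|ring].
- unfold scal; simpl; unfold mult; simpl.
  transitivity ((c * c) * (Y x (y (c * (x - a)) a) / X x (y (c * (x - a)) a))); [ring|].
  rewrite Hc2. ring.
Qed.

(** Both endpoints are on the same side of [a], and the graph does not vanish before
    either of them. *)
Lemma returns_along_unique s X g a b b' tau tau' rho :
  returns_along s X g a b tau rho -> returns_along s X g a b' tau' rho -> b = b'.
Proof.
intros [_ [Hb [gb [Hpos _]]]] [_ [Hb' [gb' [Hpos' _]]]].
assert (Hside : 0 < (b - a) * (b' - a)).
{ destruct (Rle_lt_dec (X 0 0) 0); nra. }
destruct (Rtotal_order b b') as [H|[H|H]]; [exfalso|exact H|exfalso];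
  (destruct (Rlt_le_dec a b);
   [assert (a < b') by nra | assert (b' < a) by nra]).
- specialize (Hpos' b ltac:(nra)). rewrite gb in Hpos'. lra.
- specialize (Hpos b' ltac:(nra)). rewrite gb' in Hpos. lra.
- specialize (Hpos b' ltac:(nra)). rewrite gb' in Hpos. lra.
- assert (b < a) by nra. specialize (Hpos' b ltac:(nra)). rewrite gb in Hpos'. lra.
Qed.

Lemma returns_along_half_time s s' delta X phi y x tau rho :
  returns_along s X (graph_through s' delta y x) x (phi x) tau rho ->
  half_time s' delta X phi y x = tau.
Proof.
intros [_ [Hb [_ [_ HI]]]]. unfold half_time.
rewrite (RInt_ext _ (fun p => 1 / X (x + (phi x - x) * p)
   (graph_through s' delta y x (x + (phi x - x) * p)))).
- rewrite (is_RInt_unique _ _ _ _ HI). field. intros E. rewrite E in Hb. lra.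
- intros p _. unfold graph_through. do 3 f_equal. ring.
Qed.

Lemma returns_along_half_time_opp s s' delta X phi y x tau rho :
  returns_along s (fun x y => - X x y) (graph_through s' delta y x) x (phi x) tau rho ->
  half_time s' delta X phi y x = - tau.
Proof.
intros [_ [Hb [_ [_ HI]]]]. unfold half_time.
pose proof (is_RInt_unique (V := R_CompleteNormedModule) _ _ _ _
  (is_RInt_opp (V := R_NormedModule) _ _ _ _ HI)) as E.
rewrite (RInt_ext _ (fun p => opp (1 / - X (x + (phi x - x) * p)
   (graph_through s' delta y x (x + (phi x - x) * p))))).
- etransitivity; [apply f_equal; exact E|]. unfold opp; simpl.
  field. intros E'. rewrite E' in Hb. lra.
- intros p _. unfold graph_through, opp; simpl. unfold Rdiv. rewrite Rinv_opp.
  replace (s' * delta * (x + (phi x - x) * p - x)) with (s' * delta * (phi x - x) * p) by ring.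
  ring.
Qed.

(** The field [A] points to the left at the origin and [B] to the right, so a
    trajectory through [x > 0] leaves along [A].  The two radii are nested because
    the argument is applied again at [phi x], which is only known to be smaller
    than [eta]. *)
Lemma return_time V sA sB XA YA XB YB dA dB delta yA yB phi eps eta x T :
  arcs_return_along sA V XA YA (graph_through dA delta yA) eta 1 ->
  arcs_return_along sB V XB YB (graph_through dB delta yB) eta 1 ->
  arcs_return_along sA V XA YA (graph_through dA delta yA) eps eta ->
  eps <= eta -> XA 0 0 < 0 -> 0 < XB 0 0 -> 0 < x < eps ->
  (forall a, 0 < Rabs a < eta -> exists m tau, a * m < 0 /\
     (arc sA V XA YA a m tau \/ arc sB V XB YB a m tau)) ->
  (exists tau, arc sA V XA YA x (phi x) tau \/ arc sA V XA YA (phi x) x tau) ->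
  (exists m tau1 tau2, x * m < 0 /\ T = tau1 + tau2 /\
     ((arc sA V XA YA x m tau1 /\ arc sB V XB YB m x tau2) \/
      (arc sB V XB YB x m tau1 /\ arc sA V XA YA m x tau2))) ->
  T = half_time dA delta XA phi yA x - half_time dB delta XB phi yB x.
Proof.
intros hA hB hA' heps hXA hXB hx hret [tau hphi] [m [tau1 [tau2 [Hm [-> Harcs]]]]].
assert (Hx : Rabs x = x) by (apply Rabs_pos_eq; lra).
destruct (hA x ltac:(lra)) as [hA1 hA2]. destruct (hB x ltac:(lra)) as [hB1 hB2].
assert (Hm0 : m < 0) by nra.
destruct Harcs as [[H1 H2]|[H1 _]].
2:{ apply hB1 in H1. destruct H1 as [_ [H1 _]]. nra. }
apply hA1 in H1. apply hB2 in H2.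
assert (Hphi : phi x = m).
{ destruct hphi as [hphi|hphi].
  - apply hA1 in hphi. exact (returns_along_unique _ _ _ _ _ _ _ _ _ hphi H1).
  - (* An arc of [A] ending at [x] starts to the right of [x]; but the arc of [A]
       from there has to end on the negative side. *)
    exfalso.
    assert (Hb : Rabs (phi x) < eta).
    { destruct (hA' x ltac:(lra)) as [_ h]. exact (proj1 (h _ _ hphi)). }
    assert (Hpos : x < phi x).
    { destruct (hA2 _ _ hphi) as [_ [h _]]. nra. }
    assert (Hp : Rabs (phi x) = phi x) by (apply Rabs_pos_eq; lra).
    destruct (hret (phi x) ltac:(lra)) as [m' [tau' [Hm' [Ha|Hb']]]].
    + destruct (hA (phi x) Hb) as [h _]. apply h in Ha. apply h in hphi.
      rewrite <- (returns_along_unique _ _ _ _ _ _ _ _ _ hphi Ha) in Hm'. nra.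
    + destruct (hB (phi x) Hb) as [h _]. apply h in Hb'. destruct Hb' as [_ [h' _]]. nra. }
rewrite <- Hphi in H1, H2.
rewrite (returns_along_half_time _ _ _ _ _ _ _ _ _ H1),
  (returns_along_half_time_opp _ _ _ _ _ _ _ _ _ H2).
ring.
Qed.

Theorem theorem2 (kp km : nat) (hkp : (1 <= kp)%nat) (hkm : (1 <= km)%nat)
  (V : R -> R -> Prop) (hV : open_2d V) (hV0 : V 0 0)
  (Xp Yp Xm Ym : R -> R -> R)
  (hXp : smooth_on V Xp) (hYp : smooth_on V Yp)
  (hXm : smooth_on V Xm) (hYm : smooth_on V Ym)
  (hcenter : tangential_center kp km V Xp Yp Xm Ym)
  (phi : R -> R)
  (hphip : half_return_map 1 V Xp Yp phi)
  (hphim : half_return_map (-1) V Xm Ym phi)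
  (delta : R) (hdelta : delta = sign (Xp 0 0))
  (yp ym : R -> R -> R)
  (hyp : slope_solution 1 delta V Xp Yp yp)
  (hym : slope_solution (-1) delta V Xm Ym ym)
  (T : R -> R) (hT : period_function V Xp Yp Xm Ym T) :
  exists eps : R, 0 < eps /\
    forall x, 0 <= x < eps ->
      T x = delta * (half_time (-1) delta Xm phi ym x
                     - half_time 1 delta Xp phi yp x).
Proof.
destruct hcenter as [[hinvp [hinvm [e1 [He1 hret]]]] _].
destruct hphip as [phi0 [e2 [He2 hphip]]]. destruct hphim as [_ [e3 [He3 hphim]]].
destruct hT as [T0 [e4 [He4 hT]]].
pose proof (slope_solution_neq_0 _ _ _ _ _ _ hyp) as hXp0.
assert (hdelta' : (delta = 1 /\ 0 < Xp 0 0) \/ (delta = -1 /\ Xp 0 0 < 0)).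
{ destruct (Rdichotomy _ _ hXp0) as [H|H].
  - right. split; [now rewrite hdelta, sign_eq_m1 | exact H].
  - left. split; [now rewrite hdelta, sign_eq_1 | exact H]. }
assert (hdelta2 : delta * delta = 1) by (destruct hdelta' as [[-> _]|[-> _]]; ring).
destruct (slope_solution_graphs 1 delta V Xp Yp yp ltac:(ring) hdelta2 hyp) as [rp [Hrp hGp]].
destruct (slope_solution_graphs (-1) delta V Xm Ym ym ltac:(ring) hdelta2 hym) as [rm [Hrm hGm]].
destruct (arcs_near_contact V Xp Yp 1 kp rp _ 1 hV hV0 hXp hYp Hrp hGp hinvp Rlt_0_1)
  as [ep [Hep hp1]].
destruct (arcs_near_contact V Xm Ym (-1) km rm _ 1 hV hV0 hXm hYm Hrm hGm hinvm Rlt_0_1)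
  as [em [Hem hm1]].
set (eta := Rmin e1 (Rmin ep em)).
assert (Heta : 0 < eta /\ eta <= e1 /\ eta <= ep /\ eta <= em).
{ unfold eta. split; [repeat apply Rmin_pos; assumption|].
  pose proof (Rmin_l e1 (Rmin ep em)). pose proof (Rmin_r e1 (Rmin ep em)).
  pose proof (Rmin_l ep em). pose proof (Rmin_r ep em). lra. }
destruct (arcs_near_contact V Xp Yp 1 kp rp _ eta hV hV0 hXp hYp Hrp hGp hinvp (proj1 Heta))
  as [ep' [Hep' hp2]].
destruct (arcs_near_contact V Xm Ym (-1) km rm _ eta hV hV0 hXm hYm Hrm hGm hinvm (proj1 Heta))
  as [em' [Hem' hm2]].
set (eps := Rmin (Rmin e2 e3) (Rmin (Rmin e4 eta) (Rmin ep' em'))).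
assert (Heps : 0 < eps /\ eps <= e2 /\ eps <= e3 /\ eps <= e4 /\ eps <= eta /\
               eps <= ep' /\ eps <= em').
{ unfold eps. split; [repeat apply Rmin_pos; tauto|].
  pose proof (Rmin_l (Rmin e2 e3) (Rmin (Rmin e4 eta) (Rmin ep' em'))).
  pose proof (Rmin_r (Rmin e2 e3) (Rmin (Rmin e4 eta) (Rmin ep' em'))).
  pose proof (Rmin_l (Rmin e4 eta) (Rmin ep' em')).
  pose proof (Rmin_r (Rmin e4 eta) (Rmin ep' em')).
  pose proof (Rmin_l e2 e3). pose proof (Rmin_r e2 e3).
  pose proof (Rmin_l e4 eta). pose proof (Rmin_r e4 eta).
  pose proof (Rmin_l ep' em'). pose proof (Rmin_r ep' em'). lra. }
clearbody eps. clearbody eta.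
assert (hp1' : arcs_return_along 1 V Xp Yp (graph_through 1 delta yp) eta 1).
{ intros a Ha. apply hp1. lra. }
assert (hm1' : arcs_return_along (-1) V Xm Ym (graph_through (-1) delta ym) eta 1).
{ intros a Ha. apply hm1. lra. }
assert (hp2' : arcs_return_along 1 V Xp Yp (graph_through 1 delta yp) eps eta).
{ intros a Ha. apply hp2. lra. }
assert (hm2' : arcs_return_along (-1) V Xm Ym (graph_through (-1) delta ym) eps eta).
{ intros a Ha. apply hm2. lra. }
(* A first return goes from the positive side to the negative one and back, with
   one arc of each field. *)
assert (hopp : Xp 0 0 * Xm 0 0 < 0).
{ assert (Ha : Rabs (eps / 2) = eps / 2) by (apply Rabs_pos_eq; lra).
  destruct (hret (eps / 2) ltac:(lra)) as [b [tau [m [t1 [t2 [H1 [H2 [_ [_ H]]]]]]]]].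
  assert (m < 0) by nra. assert (0 < b) by nra.
  destruct H as [[A1 A2]|[A1 A2]].
  - apply (hp2' (eps / 2) ltac:(lra)) in A1. destruct A1 as [Hm [A1 _]].
    apply (hm1' m Hm) in A2. destruct A2 as [_ [A2 _]].
    assert (Xp 0 0 < 0) by nra. assert (0 < Xm 0 0) by nra. nra.
  - apply (hm2' (eps / 2) ltac:(lra)) in A1. destruct A1 as [Hm [A1 _]].
    apply (hp1' m Hm) in A2. destruct A2 as [_ [A2 _]].
    assert (Xm 0 0 < 0) by nra. assert (0 < Xp 0 0) by nra. nra. }
exists eps. split; [tauto|]. intros x Hx.
destruct (Rle_lt_or_eq_dec 0 x (proj1 Hx)) as [Hpos| <- ].
2:{ rewrite T0. unfold half_time. rewrite phi0. ring. }
assert (Habs : Rabs x = x) by (apply Rabs_pos_eq; lra).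
destruct (hT x ltac:(lra)) as [m [t1 [t2 [H1 [_ [H2 [_ H]]]]]]].
destruct hdelta' as [[-> Hd]|[-> Hd]].
- rewrite Rmult_1_l.
  apply (return_time V (-1) 1 Xm Ym Xp Yp (-1) 1 1 ym yp phi eps eta); try tauto; try nra.
  + intros a Ha. destruct (hret a ltac:(lra)) as [b [tau [m' [t1' [t2' [K1 [_ [_ [_ K]]]]]]]]].
    exists m', t1'. tauto.
  + destruct (hphim x ltac:(lra)) as [tau K]. now exists tau.
  + exists m, t1, t2. tauto.
- transitivity (half_time 1 (-1) Xp phi yp x - half_time (-1) (-1) Xm phi ym x); [|ring].
  apply (return_time V 1 (-1) Xp Yp Xm Ym 1 (-1) (-1) yp ym phi eps eta); try tauto; try nra.
  + intros a Ha. destruct (hret a ltac:(lra)) as [b [tau [m' [t1' [t2' [K1 [_ [_ [_ K]]]]]]]]].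
    exists m', t1'. tauto.
  + destruct (hphip x ltac:(lra)) as [tau K]. now exists tau.
  + exists m, t1, t2. tauto.
Qed.
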